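(* For every integer $n\geqslant 4$, the monoid $\mathrm{PsEnd}(S_n)$ of all partial strong endomorphisms of the star graph $S_n$ has rank $6$.
   Context: For $n\geqslant1$, the star graph $S_n$ is the simple graph with vertex set $\{0,1,\ldots,n-1\}$ and edge set $E=\{\{0,i\}\mid 1\leqslant i\leqslant n-1\}$ (so $n$ vertices). $\mathcal{PT}(V)$ denotes the monoid of all partial transformations (partial maps $V\to V$, including the empty one) of a finite set $V$ under composition; maps are written on the right and composed left to right. For a graph $G=(V,E)$, a map $\alpha\in\mathcal{PT}(V)$ is a partial strong endomorphism of $G$ if for all $u,v\in\mathrm{Dom}(\alpha)$: $\{u,v\}\in E$ if and only if $\{u\alpha,v\alpha\}\in E$. $\mathrm{PsEnd}(G)$ is the set of all of them; it is a submonoid of $\mathcal{PT}(V)$. The rank of a finite monoid $M$ is the minimum size of a generating set of $M$ (as a monoid). *)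

(* Defs.v *)
From HB Require Import structures.
From mathcomp Require Import all_boot.

Set Implicit Arguments.
Unset Strict Implicit.
Unset Printing Implicit Defensive.

Local Open Scope group_scope.

#[short(type="finMonoidType")]
HB.structure Definition FinMonoid := {M of Finite M & Monoid M}.

Section Rank.
Variable M : finMonoidType.
Implicit Types A B : {set M}.

Definition submonoid B :=
  (1 \in B) && [forall x in B, forall y in B, x * y \in B].

Lemma submonoidP B : reflect (monoid_closed B) (submonoid B).
Proof.
apply: (iffP andP) => -[B1 BM]; split=> //.
  by move=> x y xB yB; move/forall_inP: BM => /(_ x xB)/forall_inP; apply.
by apply/forall_inP => x xB; apply/forall_inP => y yB; apply: BM.
Qed.

Definition mgen A : {set M} := \bigcap_(B | submonoid B && (A \subset B)) B.

Lemma mgenT : mgen [set: M] = [set: M].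
Proof.
apply/setP => x; rewrite in_setT; apply/bigcapP => B /andP[_].
by rewrite subTset => /eqP ->; rewrite in_setT.
Qed.

(* [set: M] generates M by mgenT, so the minimum is over a nonempty family *)
Definition mrank : nat :=
  #|[arg min_(A < [set: M] | mgen A == [set: M]) #|A| ]|.

Lemma mrankP r :
  mrank = r <->
    (exists2 A, mgen A = [set: M] & #|A| = r) /\
    (forall A, mgen A = [set: M] -> r <= #|A|).
Proof.
rewrite /mrank; case: arg_minnP => [|A0 /eqP genA0 minA0]; first exact/eqP/mgenT.
split=> [<-|[[A genA <-] minA]]; last first.
  by apply/eqP; rewrite eqn_leq minA // minA0 //; apply/eqP.
by split=> [|A genA]; [exists A0 | apply/minA0/eqP].
Qed.

End Rank.

Section PartialTransformations.
Variable V : finType.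

Definition ptrans := {ffun V -> option V}.
HB.instance Definition _ := Finite.on ptrans.

Implicit Types a b : ptrans.

Definition ptid : ptrans := [ffun u => Some u].

(* maps act on the right: a * b is a followed by b *)
Definition ptcomp a b : ptrans := [ffun u => obind b (a u)].

Lemma ptcompA : associative ptcomp.
Proof.
by move=> a b c; apply/ffunP => u; rewrite !ffunE; case: (a u) => //= v; rewrite ffunE.
Qed.

Lemma ptcomp1p : left_id ptid ptcomp.
Proof. by move=> a; apply/ffunP => u; rewrite !ffunE. Qed.

Lemma ptcompp1 : right_id ptid ptcomp.
Proof.
by move=> a; apply/ffunP => u; rewrite !ffunE; case: (a u) => //= v; rewrite ffunE.
Qed.

HB.instance Definition _ := isMonoid.Build ptrans ptcompA ptcomp1p ptcompp1.

Definition ptdom a : {set V} := [set u | a u].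

(* the value u is junk when u is not in ptdom a *)
Definition ptval a (u : V) : V := odflt u (a u).

End PartialTransformations.

Record sgraph := SGraph {
  vertex : finType;
  edges : {set {set vertex}};
  edges_card2 : forall e, e \in edges -> #|e| = 2
}.

Section PsEnd.
Variable G : sgraph.
Local Notation V := (vertex G).
Local Notation E := (edges G).

Definition strong_pendo : {pred ptrans V} := [pred a : ptrans V |
  [forall u in ptdom a, forall v in ptdom a,
    ([set u; v] \in E) == ([set ptval a u; ptval a v] \in E)]].

Lemma strong_pendo_closed : monoid_closed strong_pendo.
Proof.
split=> [|a b].
  by apply/forall_inP => u _; apply/forall_inP => v _; rewrite /ptval !ffunE.
move=> /forall_inP sa /forall_inP sb.
apply/forall_inP => u; rewrite inE ffunE => du.
apply/forall_inP => v; rewrite inE ffunE => dv.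
rewrite /ptval !ffunE; case au: (a u) du => [u'|] //= du.
case av: (a v) dv => [v'|] //= dv.
have := sa u; rewrite inE au => /(_ isT)/forall_inP/(_ v).
rewrite inE av /ptval au av => /(_ isT)/eqP -> /=.
have := sb u'; rewrite inE => /(_ du)/forall_inP/(_ v').
rewrite inE => /(_ dv)/eqP ->.
by rewrite /ptval; case: (b u') du => //; case: (b v') dv.
Qed.

Record PsEnd := MkPsEnd {
  psend_val :> ptrans V;
  psend_valP : psend_val \in strong_pendo
}.

HB.instance Definition _ := [isSub for psend_val].
HB.instance Definition _ := [Finite of PsEnd by <:].
HB.instance Definition _ :=
  SubChoice_isSubMonoid.Build (ptrans V) strong_pendo PsEnd strong_pendo_closed.

End PsEnd.

Section Star.
Variable n : nat.

Definition star_edges : {set {set 'I_n}} :=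
  [set [set c; i] | c in [set c : 'I_n | c == 0 :> nat],
                    i in [set i : 'I_n | 1 <= i]].

Lemma star_edges_card2 e : e \in star_edges -> #|e| = 2.
Proof.
case/imset2P=> c i; rewrite !inE => /eqP c0 i_gt0 ->.
by rewrite cards2 -val_eqE /= c0 eq_sym -lt0n i_gt0.
Qed.

Definition star_graph : sgraph := SGraph star_edges_card2.

End Star.

(* Main.v *)
(** A partial map [x] is a strong endomorphism of a star exactly when the parity
    [(u == 0) (+) (x u == 0)] is constant on its domain: it either respects the
    centre, or swaps it with the leaves.

    Upper bound.  The maps fixing the centre form a copy of the monoid of all
    partial transformations of the leaves, generated by two permutations, one
    map merging two leaves and one dropping a leaf.  Together with the map that
    drops the centre and one total map that swaps centre and leaves, they yield
    everything.

    Lower bound.  Four pairwise disjoint classes of noninvertible elements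
    ([merging], [dropping], [decentring], [swapping]) are prime, in the sense
    that a product lies in the class only if a factor does; so each contains a
    generator.  Noninvertible elements form an ideal and two invertible elements
    do not commute, so at least two generators are invertible. *)

Require Import Defs.
From mathcomp Require Import all_boot all_fingroup ssralg zmodp.

Set Implicit Arguments.
Unset Strict Implicit.
Unset Printing Implicit Defensive.

Local Open Scope group_scope.

(** * Generating sets and prime classes in a finite monoid *)

Section Generation.
Variable M : finMonoidType.
Implicit Types (A : {set M}) (P : pred M).

Lemma mgen_closed A : monoid_closed (mgen A).
Proof.
split=> [|x y xA yA]; apply/bigcapP => B /andP[sB AB].
  by case/submonoidP: sB.
have BA z : z \in mgen A -> z \in B by move/bigcapP; apply; rewrite sB.
by case/submonoidP: sB => _; apply; apply: BA.
Qed.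

Lemma sub_mgen A : {subset A <= mgen A}.
Proof. by move=> x xA; apply/bigcapP => B /andP[_ /subsetP]; apply. Qed.

(** The elements satisfying [P] form one of the submonoids intersected in [mgen A]. *)
Lemma mgen_ind A P : mgen A = [set: M] ->
  P 1 -> (forall x y, P x -> P y -> P (x * y)) -> {in A, forall x, P x} ->
  forall x, P x.
Proof.
move=> genA P1 PM PA x.
have: x \in mgen A by rewrite genA inE.
move/bigcapP => /(_ [set z | P z]); rewrite inE; apply.
apply/andP; split; last by apply/subsetP => z /PA; rewrite inE.
by apply/submonoidP; split=> [|y z]; rewrite !inE //; apply: PM.
Qed.

(* The complement of such a [P] is a submonoid, proper because of [x]. *)
Lemma gen_meets_prime A P x : mgen A = [set: M] ->
  ~~ P 1 -> (forall y z, P (y * z) -> P y || P z) -> P x ->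
  exists2 y, y \in A & P y.
Proof.
move=> genA P1 PM Px; apply/exists_inP.
apply: contraLR Px => /exists_inPn AP.
apply: (mgen_ind genA (P := predC P)) => //= y z nPy nPz.
by apply/negP => /PM; rewrite (negPf nPy) (negPf nPz).
Qed.

(* First each generator in [P], then each element of [P], is shown to commute
   with all of [P]; the complement of [P] only needs to be an ideal. *)
Lemma commuting_gens A P : mgen A = [set: M] ->
  (forall x y, P (x * y) -> P x && P y) ->
  {in A &, forall x y, P x -> P y -> x * y = y * x} ->
  forall x y, P x -> P y -> x * y = y * x.
Proof.
move=> genA PM cA.
have comm z : {in A, forall x, P x -> x * z = z * x} ->
    forall x, P x -> x * z = z * x.
  move=> cAz x Px; apply/eqP; move: Px; apply/implyP.
  apply: (mgen_ind genA (P := fun x => P x ==> (x * z == z * x))) x.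
  - by rewrite mul1g mulg1 eqxx implybT.
  - move=> x y /implyP cx /implyP cy.
    apply/implyP => /PM/andP[/cx/eqP xz /cy/eqP yz].
    by rewrite -mulgA yz mulgA xz mulgA.
  - by move=> x xA; apply/implyP => /(cAz x xA) ->.
move=> x y Px Py; apply: (comm y) Px => {}x xA Px.
by apply/esym; apply: (comm x) Py => {}y yA Py; apply: cA.
Qed.

End Generation.

(** * Generators of the monoid of all partial transformations *)

Section PartialTransformations.
Variable T : finType.
Implicit Types (f g : ptrans T) (s : {perm T}) (x y z : T).

Lemma ptM f g x : (f * g) x = obind g (f x).
Proof. by rewrite ffunE. Qed.

Definition pt_perm s : ptrans T := [ffun x => Some (s x)].

Lemma pt_permM s t : pt_perm (s * t) = pt_perm s * pt_perm t.
Proof. by apply/ffunP => x; rewrite ptM !ffunE /= ffunE permM. Qed.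

Lemma pt_perm1 : pt_perm 1 = 1.
Proof. by apply/ffunP => x; rewrite !ffunE perm1. Qed.

(** Covers both kinds of non-permutation generator: [None] deletes [x], while [Some y] with [y != x]
    merges [x] into [y]. *)
Definition pt_redef x (o : option T) : ptrans T :=
  [ffun u => if u == x then o else Some u].

(** Conjugation by permutations turns one merge and one deletion into all of them. *)
Lemma pt_redefJ s x o :
  pt_redef (s x) (omap s o) = pt_perm s^-1 * pt_redef x o * pt_perm s.
Proof.
apply/ffunP => u; rewrite !ptM !ffunE /= ffunE -[s^-1 u == x](inj_eq (@perm_inj _ s)) permKV.
case: eqP => _; last by rewrite /= ffunE permKV.
by case: o => //= v; rewrite ffunE.
Qed.

Lemma perm_carry x y u v : x != y -> u != v ->
  exists s : {perm T}, s x = u /\ s y = v.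
Proof.
move=> xy uv; exists (tperm x u * tperm (tperm x u y) v).
rewrite !permM tpermL tpermD; last by rewrite eq_sym.
  by rewrite tpermL.
by rewrite -{2}(tpermL x u) (inj_eq perm_inj) eq_sym.
Qed.

(* If [f] is not a permutation, some [x] contributes nothing to the image of
   [f] and some [z] is outside it; redefining [f x] as [z] enlarges the image,
   and composing with [pt_redef z (f x)] gives [f] back. *)
Lemma ptrans_gen (B : {pred ptrans T}) x0 y0 :
    x0 != y0 -> monoid_closed B -> (forall s, pt_perm s \in B) ->
    pt_redef x0 (Some y0) \in B -> pt_redef x0 None \in B ->
  forall f, f \in B.
Proof.
move=> x0y0 [_ BM] Bperm Bmerge Bdrop.
have Bredef z o : o != Some z -> pt_redef z o \in B.
  case: o => [w zw|_].
    have {}zw : z != w by apply: contraNneq zw => ->.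
    have [s [sx sy]] := perm_carry x0y0 zw.
    have -> : Some w = omap s (Some y0) by rewrite /= sy.
    rewrite -sx.
    by rewrite pt_redefJ !BM.
  have -> : z = tperm x0 z x0 by rewrite tpermL.
  by rewrite (pt_redefJ _ _ None) !BM.
(* Induction on the number of points outside the image. *)
move=> f; have [k] := ubnP #|[set z | Some z \notin codom f]|.
elim: k f => // k IHk f; rewrite ltnS => lek.
case: (boolP [forall x, f x && [forall y, (f x == f y) ==> (x == y)]]) => [|].
  move=> /forallP inj_f.
  have fE x : f x = Some (ptval f x).
    by case/andP: (inj_f x); rewrite /ptval; case: (f x).
  have val_inj : injective (ptval f).
    move=> x y eqxy; case/andP: (inj_f x) => _ /forallP/(_ y)/implyP inj_x.
    by apply/eqP/inj_x; rewrite !fE eqxy.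
  suff -> : f = pt_perm (perm val_inj) by [].
  by apply/ffunP => x; rewrite ffunE permE fE.
case/forallPn => x xP.
have redundant u : u \in codom f -> u -> u \in [seq f v | v in [set~ x]].
  case/codomP => v ->; case: (eqVneq v x) => [->|vx] fv; last first.
    by apply: map_f; rewrite mem_enum !inE.
  move: xP; rewrite negb_and fv /= => /forallPn[y].
  rewrite negb_imply => /andP[/eqP -> xy].
  by apply: map_f; rewrite mem_enum !inE eq_sym.
(* Pigeonhole: otherwise all [#|T|] points would occur among the values of [f] on the [#|T| - 1]
   points other than [x]. *)
have [z zf] : exists z, Some z \notin codom f.
  case: (boolP [exists z, Some z \notin codom f]) => [/existsP //|].
  move/existsPn => full.
  have: size [seq Some z | z : T] <= size [seq f v | v in [set~ x]].
    apply: uniq_leq_size => [|_ /mapP[z _ ->]].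
      by rewrite map_inj_uniq ?enum_uniq // => ? ? [].
    by apply: redundant => //; apply/negPn.
  have T_gt0 : 0 < #|T| by apply/card_gt0P; exists x.
  by rewrite !size_map -enumT -!cardE cardsC1 -{1}(prednK T_gt0) ltnn.
pose f' : ptrans T := [ffun u => if u == x then Some z else f u].
have -> : f = f' * pt_redef z (f x).
  apply/ffunP => u; rewrite ptM !ffunE; case: (eqVneq u x) => [->|ux] /=.
    by rewrite ffunE eqxx.
  case fu: (f u) => [w|] //=; rewrite ffunE; case: (eqVneq w z) => // wz.
  by case/negP: zf; rewrite -wz -fu codom_f.
apply: BM; last first.
  by apply: Bredef; apply: contraNneq zf => <-; apply: codom_f.
apply: IHk; apply: leq_trans lek; apply: proper_card; apply/properP; split.
  apply/subsetP => w; rewrite !inE; apply: contra => wf.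
  have /imageP[v vx ->] := redundant _ wf isT.
  move: vx; rewrite !inE => /negPf vx.
  by apply/codomP; exists v; rewrite ffunE vx.
exists z; rewrite !inE // negbK; apply/codomP; exists x.
by rewrite ffunE eqxx.
Qed.

End PartialTransformations.

Lemma Sym_2gen n :
  exists s t : 'S_n.+2, <<[set s; t]>> = [set: 'S_n.+2].
Proof.
(* The transposition of 0 and 1, and the full cycle adding 1 modulo [n.+2]. *)
exists (tperm (0%R : 'I_n.+2) 1%R).
exists (perm (GRing.addrI (1%R : 'I_n.+2))).
by apply: gen_tpermn_circular_shift; rewrite GRing.subr0 coprimen1.
Qed.

Identity Coercion ffun_of_ptrans : ptrans >-> finfun_of.

(** * Parity of strong endomorphisms of a star, and separation of leaves *)

Section Star.
Variable m : nat.
Local Notation V := 'I_m.+1.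
Local Notation M := (PsEnd (star_graph m.+1)).
Implicit Types (x y : M) (u v w : V).

Lemma star_adj u v :
  ([set u; v] \in star_edges m.+1) = (u == ord0) (+) (v == ord0).
Proof.
apply/imset2P/idP => [[c i]|].
  rewrite !inE => /eqP c0 i_gt0 /setP uv.
  have {c0} ec : c = ord0 by apply/val_inj.
  have i0 : i != ord0 by rewrite -val_eqE /= -lt0n.
  have := uv ord0; have := uv i; rewrite !inE ec !eqxx orbT /= => /orP iuv /orP ouv.
  by case: ouv iuv => /eqP <- [] /eqP iE; move: i0; rewrite -?iE eqxx // => /negPf ->.
case: (eqVneq u ord0) => [->|u0] /=.
  by move=> v0; exists ord0 v; rewrite ?inE ?lt0n.
case: (eqVneq v ord0) => [-> _|//]; exists ord0 u; rewrite ?inE ?lt0n //.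
by rewrite setUC.
Qed.

Lemma strong_starP (a : ptrans V) :
  reflect (exists b, forall u v, a u = Some v -> (v == ord0) = b (+) (u == ord0))
          (a \in @strong_pendo (star_graph m.+1)).
Proof.
apply: (iffP forall_inP) => [sa|[b ab] u].
  case: (boolP [exists u, a u]) => [/existsP[u0 du0]|/existsPn nodom]; last first.
    (* On the empty domain both parities hold vacuously. *)
    by exists false => u v au; move: (nodom u); rewrite au.
  exists ((u0 == ord0) (+) (ptval a u0 == ord0)) => u v au.
  have := sa u0; rewrite inE => /(_ du0)/forall_inP/(_ u).
  rewrite inE au => /(_ isT)/eqP; rewrite !star_adj {2}/ptval au /=.
  by case: (u0 == _); case: (u == _); case: (_ == ord0); case: (v == _).
rewrite inE /ptval => du; apply/forall_inP => v; rewrite inE => dv.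
case au: (a u) du => [u'|//] _; case av: (a v) dv => [v'|//] _ /=.
by rewrite !star_adj (ab _ _ au) (ab _ _ av); case: (b) (u == _) (v == _) => [] [] [].
Qed.

Lemma psend_star x :
  exists b, forall u v, x u = Some v -> (v == ord0) = b (+) (u == ord0).
Proof. by apply/strong_starP; apply: psend_valP. Qed.

Lemma psendM x y u : (x * y) u = obind y (x u).
Proof. by rewrite ffunE. Qed.

Lemma psend1 u : (1 : M) u = Some u.
Proof. by rewrite ffunE. Qed.

Lemma psend_eq x y : x =1 y -> x = y.
Proof. by move=> xy; apply/val_inj/ffunP. Qed.

(** A canonical choice of the parity [b] of [psend_star]; it is [false] for the empty map, whose
    parity is ambiguous. *)
Definition flips x :=
  [exists u, exists v, (x u == Some v) && ((u == ord0) != (v == ord0))].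

Lemma flipsP x u v : x u = Some v -> (v == ord0) = flips x (+) (u == ord0).
Proof.
have [b xb] := psend_star x => xu; rewrite (xb _ _ xu); congr (_ (+) _).
apply/idP/existsP => [bT|[u1 /existsP[v1 /andP[/eqP/xb ->]]]].
  exists u; apply/existsP; exists v; rewrite xu eqxx (xb _ _ xu) bT.
  by case: (u == _).
by case: b xb; case: (u1 == _).
Qed.

Definition total x := [forall u, x u].

Definition separates x :=
  [exists u, exists v, [&& u != ord0, v != ord0, x u, x v & x u != x v]].

Lemma separatesP x :
  reflect (exists u v u' v', [/\ u != ord0, v != ord0, x u = Some u',
             x v = Some v' & u' != v'])
          (separates x).
Proof.
apply: (iffP existsP) => [[u /existsP[v /and5P[u0 v0]]]|].
  case xu: (x u) => [u'|//] _; case xv: (x v) => [v'|//] _ uv.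
  by exists u, v, u', v'; split=> //; apply: contraNneq uv => ->.
case=> u [v [u' [v' [u0 v0 xu xv uv]]]]; exists u; apply/existsP; exists v.
by rewrite u0 v0 xu xv /=; apply: contraNneq uv => -[->].
Qed.

(** A flipping map sends every leaf of its domain to the centre, so it cannot tell two leaves
    apart. *)
Lemma separates_flips x : separates x -> flips x = false.
Proof.
case/separatesP=> u [v [u' [v' [/negPf u0 /negPf v0 /flipsP xu /flipsP xv]]]].
rewrite u0 v0 in xu xv; case: (flips x) xu xv => //= /eqP-> /eqP->.
by rewrite eqxx.
Qed.

Lemma separates_mull x y : separates (x * y) -> separates x.
Proof.
case/separatesP=> u [v [u' [v' [u0 v0]]]]; rewrite !psendM.
case xu: (x u) => [u1|//]; case xv: (x v) => [v1|//] /= yu yv uv.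
apply/separatesP; exists u, v, u1, v1; split=> //.
by apply: contraNneq uv => uv1; move: yu; rewrite uv1 yv => -[->].
Qed.

(** Since [x] separates, it does not flip, so the two leaves reach [y] as leaves. *)
Lemma separates_mulr x y : separates (x * y) -> separates y.
Proof.
move=> sxy; have xF := separates_flips (separates_mull sxy).
case/separatesP: sxy => u [v [u' [v' [u0 v0]]]]; rewrite !psendM.
case xu: (x u) => [u1|//]; case xv: (x v) => [v1|//] /= yu yv uv.
by apply/separatesP; exists u1, v1, u', v'; rewrite (flipsP xu) (flipsP xv) xF.
Qed.

Lemma separates_fix0 x v : separates x -> x ord0 = Some v -> v = ord0.
Proof. by move/separates_flips=> xF /flipsP; rewrite xF eqxx => /eqP. Qed.

Lemma total_mull x y : total (x * y) -> total x.
Proof.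
by move/forallP=> txy; apply/forallP => u; move: (txy u); rewrite psendM; case: (x u).
Qed.

Lemma injective_mull x y : injective (x * y) -> injective x.
Proof. by move=> ixy u v xuv; apply: ixy; rewrite !psendM xuv. Qed.

Lemma total_inj_onto x : total x -> injective x -> forall v, exists u, x u = Some v.
Proof.
move=> /forallP tx ix v.
have xE u : x u = Some (ptval x u) by rewrite /ptval; case: (x u) (tx u).
have pi : injective (ptval x) by move=> u w e; apply: ix; rewrite !xE e.
by exists (invF pi v); rewrite xE f_invF.
Qed.

Lemma total_mulr x y : total x -> injective x -> total (x * y) -> total y.
Proof.
move=> tx ix /forallP txy; apply/forallP => v.
by have [u xu] := total_inj_onto tx ix v; move: (txy u); rewrite psendM xu.
Qed.

Lemma injective_mulr x y :
  total x -> injective x -> injective (x * y) <-> injective y.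
Proof.
move=> tx ix; split=> [ixy v v' yvv'|iy u v].
  have [u xu] := total_inj_onto tx ix v; have [u' xu'] := total_inj_onto tx ix v'.
  have uu' : u = u' by apply: ixy; rewrite !psendM xu xu'.
  by move: xu; rewrite uu' xu' => -[].
move/forallP: tx => tx; rewrite !psendM => xuv; apply: ix.
case xu: (x u) (tx u) xuv => [u'|//] _; case xv: (x v) (tx v) => [v'|//] _ /= /iy.
by move->.
Qed.

(** * Invertible elements and the four prime classes *)

Definition invertible x := total x && injectiveb x.

Lemma invertible_mul x y : invertible (x * y) -> invertible x && invertible y.
Proof.
case/andP=> txy /injectiveP ixy.
have tx := total_mull txy; have ix := injective_mull ixy.
rewrite /invertible tx (total_mulr tx ix txy) /=.
by apply/andP; split; apply/injectiveP => //; apply/(injective_mulr y tx ix).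
Qed.

Definition merging x := [&& total x, separates x & ~~ injectiveb x].

(** Both factors separate and [x] is total. If [x] is also injective, it is a permutation, so [y] is
    total and must itself fail to be injective. *)
Lemma merging_prime x y : merging (x * y) -> merging x || merging y.
Proof.
case/and3P=> txy sxy /injectiveP ixy; have tx := total_mull txy.
rewrite /merging tx (separates_mull sxy) (separates_mulr sxy) /=.
case: (injectiveP x) => //= ix; rewrite (total_mulr tx ix txy).
by apply/injectiveP => iy; apply/ixy/injective_mulr.
Qed.

Definition dropping x := [&& ~~ total x, separates x & x ord0].

(** As [x] separates, it fixes the centre, so both factors are defined there; they cannot both be
    total. *)
Lemma dropping_prime x y : dropping (x * y) -> dropping x || dropping y.
Proof.
case/and3P=> ntxy sxy; rewrite psendM /dropping.
have sx := separates_mull sxy; rewrite sx (separates_mulr sxy) /=.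
case x0: (x ord0) => [v|//] /=; rewrite (separates_fix0 sx x0) => -> /=.
rewrite !andbT -negb_and; apply: contra ntxy => /andP[/forallP tx /forallP ty].
by apply/forallP => u; rewrite psendM; case: (x u) (tx u) => /= [w _|].
Qed.

Definition decentring x := separates x && ~~ x ord0.

Lemma decentring_prime x y : decentring (x * y) -> decentring x || decentring y.
Proof.
case/andP=> sxy; rewrite psendM /decentring.
have sx := separates_mull sxy; rewrite sx (separates_mulr sxy) /=.
by case x0: (x ord0) => [v|//] /=; rewrite (separates_fix0 sx x0).
Qed.

Definition swapping x :=
  [&& flips x, x ord0 : bool & [exists u, (u != ord0) && x u]].

(** If [x] flips, it is swapping, being defined at the centre and at the leaf [u]. Otherwise it
    fixes the centre and sends [u] to a leaf, and [y] does the swapping. *)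
Lemma swapping_prime x y : swapping (x * y) -> swapping x || swapping y.
Proof.
case/and3P=> fxy xy0 /existsP[u /andP[u0]]; rewrite psendM.
case xu: (x u) => [v|//] /=; case yv: (y v) => [w|//] _.
have xyu : (x * y) u = Some w by rewrite psendM xu.
move: (flipsP xu) (flipsP yv) (flipsP xyu) xy0; rewrite fxy (negPf u0) psendM.
case x0: (x ord0) => [v0|//] /=; move: (flipsP x0); rewrite eqxx.
case xF: (flips x) => /= v0P vP wP wP' yv0; apply/orP; [left|right].
  by rewrite /swapping xF x0 /=; apply/existsP; exists u; rewrite u0 xu.
rewrite /swapping; move/eqP: v0P yv0 => -> ->; rewrite andTb; apply/andP; split.
  by move: wP; rewrite wP' vP; case: (flips y).
by apply/existsP; exists v; rewrite vP yv.
Qed.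

(** * Embedding the partial transformations of the leaves, and factorizations *)

Implicit Types (f g : ptrans 'I_m) (i j : 'I_m).

Lemma V_ind (P : V -> Prop) : P ord0 -> (forall i, P (lift ord0 i)) -> forall u, P u.
Proof. by move=> P0 PS u; case: (unliftP ord0 u) => [i ->|->]. Qed.

Lemma lift_ord0F i : (lift ord0 i == ord0) = false.
Proof. by apply/negbTE; rewrite eq_sym neq_lift. Qed.

Definition fix_centre_fun f : ptrans V :=
  [ffun u => if unlift ord0 u is Some i then omap (lift ord0) (f i) else Some ord0].

Lemma fix_centre_strong f : fix_centre_fun f \in @strong_pendo (star_graph m.+1).
Proof.
apply/strong_starP; exists false => u v; elim/V_ind: u => [|i]; rewrite ffunE.
  by rewrite unlift_none => -[<-].
by rewrite liftK lift_ord0F; case: (f i) => //= j [<-]; rewrite lift_ord0F.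
Qed.

Definition fix_centre f : M := MkPsEnd (fix_centre_strong f).

Lemma fix_centre0 f : fix_centre f ord0 = Some ord0.
Proof. by rewrite ffunE unlift_none. Qed.

Lemma fix_centreS f i : fix_centre f (lift ord0 i) = omap (lift ord0) (f i).
Proof. by rewrite ffunE liftK. Qed.

Lemma fix_centreM f g : fix_centre (f * g) = fix_centre f * fix_centre g.
Proof.
apply: psend_eq; elim/V_ind => [|i].
  by rewrite psendM !fix_centre0 /= fix_centre0.
by rewrite psendM !fix_centreS ptM; case: (f i) => //= j; rewrite fix_centreS.
Qed.

Lemma fix_centre1 : fix_centre 1 = 1.
Proof.
apply: psend_eq; elim/V_ind => [|i]; rewrite psend1 ?fix_centre0 //.
by rewrite fix_centreS ffunE.
Qed.

Lemma fix_centre_inj : injective fix_centre.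
Proof.
move=> f g fg; apply/ffunP => i; have := fix_centreS f i.
rewrite fg fix_centreS; by case: (f i) (g i) => [j|] [l|] //= /Some_inj/lift_inj ->.
Qed.

Lemma total_fix_centre f : total (fix_centre f) = [forall i, f i].
Proof.
apply/forallP/forallP => tf => [i|].
  by move: (tf (lift ord0 i)); rewrite fix_centreS; case: (f i).
elim/V_ind => [|i]; first by rewrite fix_centre0.
by rewrite fix_centreS; case: (f i) (tf i).
Qed.

Lemma separates_fix_centre f i j :
  f i -> f j -> f i != f j -> separates (fix_centre f).
Proof.
move=> fi fj fij; apply/existsP; exists (lift ord0 i); apply/existsP.
exists (lift ord0 j); rewrite !fix_centreS !lift_ord0F.
case: (f i) fi fij => [i'|//] _; case: (f j) fj => [j'|//] _ /=.
by rewrite !(inj_eq Some_inj) (inj_eq lift_inj).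
Qed.

Definition drop_centre_fun : ptrans V := [ffun u => if u == ord0 then None else Some u].

Lemma drop_centre_strong : drop_centre_fun \in @strong_pendo (star_graph m.+1).
Proof. by apply/strong_starP; exists false => u v; rewrite ffunE; case: ifP => // u0 [<-]. Qed.

Definition drop_centre : M := MkPsEnd drop_centre_strong.

Definition swap_centre_fun i : ptrans V :=
  [ffun u => Some (if u == ord0 then lift ord0 i else ord0)].

Lemma swap_centre_strong i : swap_centre_fun i \in @strong_pendo (star_graph m.+1).
Proof.
apply/strong_starP; exists true => u v; rewrite ffunE => -[<-].
by case: ifP => u0; rewrite ?lift_ord0F ?eqxx.
Qed.

Definition swap_centre i : M := MkPsEnd (swap_centre_strong i).

(** A leaf sent to the centre becomes undefined; for a non-flipping map there is no such leaf, so
    nothing is lost. *)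
Definition leaf_part x : ptrans 'I_m :=
  [ffun i => obind (unlift ord0) (x (lift ord0 i))].

(** For a flipping map the domain determines the action on leaves, all of which go to the centre. *)
Definition leaf_dom x : ptrans 'I_m := [ffun i => if x (lift ord0 i) then Some i else None].

Lemma leaf_partE x : flips x = false -> x ord0 ->
  x = fix_centre (leaf_part x).
Proof.
move=> xF x0; apply: psend_eq; elim/V_ind => [|i].
  case xE: (x ord0) x0 => [v|//] _; move/flipsP: xE; rewrite xF eqxx => /eqP->.
  by rewrite fix_centre0.
rewrite fix_centreS ffunE; case xi: (x (lift ord0 i)) => [v|] //=.
move: (flipsP xi); rewrite xF lift_ord0F /=.
by case: (unliftP ord0 v) => [j -> //|->]; rewrite eqxx.
Qed.

Lemma leaf_partE0 x : flips x = false -> x ord0 = None ->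
  x = drop_centre * fix_centre (leaf_part x).
Proof.
move=> xF x0; apply: psend_eq; elim/V_ind => [|i]; rewrite psendM ffunE ?eqxx //.
rewrite lift_ord0F /= fix_centreS ffunE; case xi: (x (lift ord0 i)) => [v|] //=.
move: (flipsP xi); rewrite xF lift_ord0F /=.
by case: (unliftP ord0 v) => [j -> //|->]; rewrite eqxx.
Qed.

(** The last factor collapses all leaves to [j], which moves the image of the centre from [i] to [j]
    and keeps the leaf images at the centre. *)
Lemma swap_leaf_dom x i j : flips x -> x ord0 = Some (lift ord0 j) ->
  x = fix_centre (leaf_dom x) * swap_centre i * fix_centre [ffun=> Some j].
Proof.
move=> xF x0; apply: psend_eq; elim/V_ind => [|l]; rewrite !psendM.
  by rewrite fix_centre0 x0 /= ffunE /= fix_centreS ffunE.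
rewrite fix_centreS ffunE; case xl: (x (lift ord0 l)) => [v|] //=.
rewrite ffunE lift_ord0F /= fix_centre0.
by move: (flipsP xl); rewrite xF lift_ord0F => /eqP->.
Qed.

Lemma swap_leaf_dom0 x i : flips x -> x ord0 = None ->
  x = drop_centre * fix_centre (leaf_dom x) * swap_centre i.
Proof.
move=> xF x0; apply: psend_eq; elim/V_ind => [|l]; rewrite !psendM.
  by rewrite ffunE eqxx x0.
rewrite ffunE lift_ord0F /= fix_centreS ffunE; case xl: (x (lift ord0 l)) => [v|] //=.
rewrite ffunE lift_ord0F.
by move: (flipsP xl); rewrite xF lift_ord0F => /eqP->.
Qed.

End Star.

(** * Upper bound: six generators *)

Section Rank.
Variable k : nat.
Local Notation M := (PsEnd (star_graph k.+4)).
Implicit Types (A : {set M}) (x y : M).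

(** Three distinct leaves: [i1] and [i2] stay separated when [i0] is merged or dropped, and their
    transpositions do not commute. *)
Let i0 : 'I_k.+3 := ord0.
Let i1 : 'I_k.+3 := lift ord0 ord0.
Let i2 : 'I_k.+3 := lift ord0 (lift ord0 ord0).

Definition star_gens (s t : 'S_k.+3) : seq M :=
  [:: fix_centre (pt_perm s); fix_centre (pt_perm t);
      fix_centre (pt_redef i0 (Some i1)); fix_centre (pt_redef i0 None);
      drop_centre k.+3; swap_centre i0].

Lemma star_gens_mgen s t : <<[set s; t]>> = [set: 'S_k.+3] ->
  mgen [set x in star_gens s t] = [set: M].
Proof.
move=> genS; set A := [set x in _]; have [A1 AM] := mgen_closed A.
have inA x : x \in star_gens s t -> x \in mgen A.
  by move=> xs; apply: sub_mgen; rewrite inE.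
have fixA f : fix_centre f \in mgen A.
  pose B := [pred f | fix_centre f \in mgen A].
  have BM : monoid_closed B.
    split=> [|g h]; rewrite !inE ?fix_centre1 //.
    by rewrite fix_centreM; apply: AM.
  apply: (ptrans_gen (B := B) (x0 := i0) (y0 := i1)) => //;
    try by apply: inA; rewrite !inE eqxx ?orbT.
  (* In a finite group, closure under products suffices for a subgroup, so group generation by [s]
     and [t] transfers to the monoid. *)
  pose G := [set p : 'S_k.+3 | pt_perm p \in B].
  have gG : group_set G.
    apply/group_setP; split=> [|p q]; first by rewrite inE pt_perm1; case: BM.
    by rewrite !inE pt_permM; apply: BM.2.
  move=> p; have : p \in Group gG.
    have /subsetP -> // : [set: 'S_k.+3] \subset Group gG.
    rewrite -genS gen_subG; apply/subsetP => q.
    by rewrite !inE => /orP[] /eqP ->; apply: inA; rewrite !inE eqxx ?orbT.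
  by rewrite inE.
have dropA : drop_centre k.+3 \in mgen A by apply: inA; rewrite !inE eqxx ?orbT.
have swapA : swap_centre i0 \in mgen A by apply: inA; rewrite !inE eqxx ?orbT.
(* Each combination of flipping or not, and centre in the domain or not, has its own
   factorization. *)
apply/setP => x; rewrite [RHS]inE; case xF: (flips x); case x0: (x ord0) => [v|].
- have: v != ord0 by rewrite (flipsP x0) xF eqxx.
  case: (unliftP ord0 v) x0 => [j ->|->] x0; rewrite ?eqxx // => _.
  by rewrite (swap_leaf_dom i0 xF x0) !AM.
- by rewrite (swap_leaf_dom0 i0 xF x0) !AM.
- by rewrite (leaf_partE xF) ?x0 ?fixA.
- by rewrite (leaf_partE0 xF x0) AM.
Qed.

(** * Lower bound: six distinct generators in every generating set *)

Let class x : nat :=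
  (if ~~ separates x then 0 else if ~~ x ord0 then 1 else
   if ~~ total x then 2 else 3 + injectiveb x)%N.

Lemma invertible_separates x : invertible x -> separates x.
Proof.
case/andP=> /forallP tx /injectiveP ix; apply/existsP; exists (lift ord0 i0).
apply/existsP; exists (lift ord0 i1); rewrite !lift_ord0F !tx /=.
by rewrite (inj_eq ix) (inj_eq lift_inj).
Qed.

Lemma invertible_perm (s : 'S_k.+3) : invertible (fix_centre (pt_perm s)).
Proof.
apply/andP; split; first by rewrite total_fix_centre; apply/forallP => i; rewrite ffunE.
apply/injectiveP; elim/V_ind => [|i]; elim/V_ind => [|j] //;
  rewrite ?fix_centre0 ?fix_centreS ?ffunE //=.
by move=> /Some_inj/lift_inj/perm_inj ->.
Qed.

Lemma invertible1 : invertible (1 : M).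
Proof.
by apply/andP; split; [apply/forallP => u|apply/injectiveP => u v];
   rewrite !psend1 // => -[].
Qed.

Lemma mgen_star_geq6 A : mgen A = [set: M] -> 6 <= #|A|.
Proof.
move=> genA.
have [t1 i1x] := andP invertible1.
have [a aA Pa] : exists2 a, a \in A & merging a.
  apply: (gen_meets_prime genA _ (@merging_prime _)
            (x := fix_centre (pt_redef i0 (Some i1)))).
    by rewrite /merging i1x !andbF.
  apply/and3P; split.
  - by rewrite total_fix_centre; apply/forallP => i; rewrite ffunE; case: ifP.
  - by apply: (@separates_fix_centre _ _ i1 i2); rewrite !ffunE.
  - apply/injectiveP => /(_ (lift ord0 i0) (lift ord0 i1)).
    by rewrite !fix_centreS !ffunE /= => /(_ erefl)/lift_inj.
have [b bA Pb] : exists2 b, b \in A & dropping b.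
  apply: (gen_meets_prime genA _ (@dropping_prime _)
            (x := fix_centre (pt_redef i0 None))).
    by rewrite /dropping t1.
  apply/and3P; split; last by rewrite fix_centre0.
  - by rewrite total_fix_centre; apply/forallPn; exists i0; rewrite ffunE.
  - by apply: (@separates_fix_centre _ _ i1 i2); rewrite !ffunE.
have [c cA Pc] : exists2 c, c \in A & decentring c.
  apply: (gen_meets_prime genA _ (@decentring_prime _) (x := drop_centre k.+3)).
    by rewrite /decentring psend1 andbF.
  apply/andP; split; last by rewrite ffunE eqxx.
  apply/existsP; exists (lift ord0 i0); apply/existsP; exists (lift ord0 i1).
  by rewrite !ffunE !lift_ord0F.
have [d dA Pd] : exists2 d, d \in A & swapping d.
  apply: (gen_meets_prime genA _ (@swapping_prime _) (x := swap_centre i0)).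
    by rewrite /swapping separates_flips // invertible_separates // invertible1.
  apply/and3P; split; last by apply/existsP; exists (lift ord0 i0); rewrite ffunE.
    have /flipsP : swap_centre i0 ord0 = Some (lift ord0 i0) by rewrite ffunE.
    by rewrite lift_ord0F eqxx; case: flips.
  by rewrite ffunE.
have [s [t [sA tA Ps Pt st]]] : exists s t, [/\ s \in A, t \in A,
    invertible s, invertible t & s != t].
  case: (boolP [exists s in A, exists t in A,
                  [&& invertible s, invertible t & s != t]]).
    by case/exists_inP=> s sA /exists_inP[t tA /and3P[]]; exists s, t.
  (* Now any two invertible generators are equal, hence commute, and [commuting_gens] extends this
     to all invertible elements. *)
  move/exists_inPn => comm.
  have comm_units := commuting_gens genA (@invertible_mul _) _.
  have: fix_centre (pt_perm (tperm i0 i1)) * fix_centre (pt_perm (tperm i1 i2)) =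
        fix_centre (pt_perm (tperm i1 i2)) * fix_centre (pt_perm (tperm i0 i1)).
    apply: comm_units; try exact: invertible_perm.
    move=> s t sA tA Ps Pt; have /exists_inPn/(_ t tA) := comm s sA.
    by rewrite Ps Pt /= negbK => /eqP ->.
  (* The two products send [i0] to [i2] and to [i1] respectively. *)
  rewrite -!fix_centreM -!pt_permM => /fix_centre_inj/ffunP/(_ i0).
  by rewrite !ffunE !permM tpermL tpermL (@tpermD _ i1 i2 i0) // tpermL => -[].
(* The tags 4 to 0 mark invertible, merging, dropping, decentring and swapping elements. Different
   tags force different generators; only [s] and [t] share one, and [st] tells them apart. *)
have classP : [/\ class s = 4, class t = 4, class a = 3, class b = 2
              & class c = 1%N /\ class d = 0].
  rewrite /class; split.
  - rewrite invertible_separates //.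
    by case/andP: Ps => ts ->; rewrite ts (forallP ts).
  - rewrite invertible_separates //.
    by case/andP: Pt => tt ->; rewrite tt (forallP tt).
  - by case/and3P: Pa => ta -> /negPf ->; rewrite ta (forallP ta).
  - by case/and3P: Pb => -> -> ->.
  - split; first by case/andP: Pc => -> ->.
    by case/and3P: Pd => fd _ _; case: ifPn => // /negPn/separates_flips; rewrite fd.
have [cs ct ca cb [cc cd]] := classP.
apply/card_geqP; exists [:: s; t; a; b; c; d]; split=> //.
  have ne x y : class x != class y -> x != y by apply: contra_neq => ->.
  by rewrite /= !inE !negb_or st !ne // ?cs ?ct ?ca ?cb ?cc ?cd.
by apply/allP; rewrite /= sA tA aA bA cA dA.
Qed.

End Rank.

Theorem theorem3p2 (n : nat) (hn : 4 <= n) : mrank (PsEnd (star_graph n)) = 6.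
Proof.
case: n hn => [|[|[|[|k]]]] // _; apply/mrankP; split; last exact: mgen_star_geq6.
have [s [t genS]] := Sym_2gen k.+1; have gen := star_gens_mgen genS.
exists [set x in star_gens s t] => //; apply/eqP.
(* A list of length six gives at most six elements; the lower bound shows that they are distinct. *)
rewrite eqn_leq mgen_star_geq6 // andbT.
by rewrite cardsE; apply: card_size.
Qed.
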